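(* Suppose that $f$ has the MLR property, i.e. $f(x_1-\eta_1)f(x_2-\eta_2)\ge f(x_1-\eta_2)f(x_2-\eta_1)$ whenever $x_1<x_2$ and $\eta_1<\eta_2$; that $W$ satisfies (C1)--(C3) (listed in the context); and that for every fixed $u>0$ and $\theta\ge 0$ the function $$c\mapsto \frac{\int_{-\infty}^{\infty}W(z-c)[f(z-u+\theta)f(z)+f(z-u)f(z+\theta)]\,dz}{\int_{-\infty}^{\infty}[f(z-u+\theta)f(z)+f(z-u)f(z+\theta)]\,dz}$$ has a unique minimizer $c(\theta,u)$, which is the unique solution $c$ of $\int_{-\infty}^{\infty}W'(z-c)[f(z-u+\theta)f(z)+f(z-u)f(z+\theta)]\,dz=0$. Let $c_0$ be the unique solution of $\int_{-\infty}^{\infty}W'(x-c_0)f(x)\,dx=0$. If $P_{\boldsymbol\theta}(c_0>c(0,U))>0$ for some $\boldsymbol\theta\in\mathbb{R}^2$, then the estimator $$\delta_{\phi_0}(\mathbf X)=X_{(2)}-\min\{c_0,c(0,U)\}$$ improves upon the natural estimator $\delta_{c_0}(\mathbf X)=X_{(2)}-c_0$ for estimating $\theta_{(2)}$ under the loss $W(a-\theta_{(2)})$.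
   Context: Setting: $f$ is a Lebesgue probability density on $\mathbb{R}$; $X_1,X_2$ are independent and $X_i$ has density $x\mapsto f(x-\theta_i)$, where $\boldsymbol\theta=(\theta_1,\theta_2)\in\mathbb{R}^2$ is unknown. Write $\theta_{(1)}=\min\{\theta_1,\theta_2\}$, $\theta_{(2)}=\max\{\theta_1,\theta_2\}$, $X_{(1)}=\min\{X_1,X_2\}$, $X_{(2)}=\max\{X_1,X_2\}$, $U=X_{(2)}-X_{(1)}$, $\mathbf X=(X_1,X_2)$. The loss for estimating $\theta_{(2)}$ is $L(\boldsymbol\theta,a)=W(a-\theta_{(2)})$, $W:\mathbb{R}\to[0,\infty)$; the risk of $\delta$ is $R(\boldsymbol\theta,\delta)=E_{\boldsymbol\theta}[W(\delta(\mathbf X)-\theta_{(2)})]$. Conditions on $W$: (C1) $W(0)=0$, $W$ is strictly decreasing on $(-\infty,0)$ and strictly increasing on $(0,\infty)$; (C2) $W'$ is increasing almost everywhere; (C3) the integrals involving $W$ are finite and differentiation under the integral sign is permissible. ''$\delta'$ improves upon $\delta$'' means $R(\boldsymbol\theta,\delta')\le R(\boldsymbol\theta,\delta)$ for all $\boldsymbol\theta\in\mathbb{R}^2$, with strict inequality for some $\boldsymbol\theta$. *)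

(* Defs.v *)
From HB Require Import structures.
From mathcomp Require Import all_boot all_order all_algebra.
From mathcomp Require Import all_classical all_reals all_analysis.

Set Implicit Arguments.
Unset Strict Implicit.
Unset Printing Implicit Defensive.

Import Order.TTheory GRing.Theory Num.Theory.
Import numFieldNormedType.Exports.

Local Open Scope classical_set_scope.
Local Open Scope ring_scope.

Section location_densities.
Context {R : realType}.
Implicit Types f : R -> R.

Definition is_pdf f :=
  [/\ measurable_fun setT f, forall x, 0 <= f x &
      (\int[lebesgue_measure]_x (f x)%:E = 1)%E].

Definition MLR f := forall x1 x2 eta1 eta2, x1 < x2 -> eta1 < eta2 ->
  f (x1 - eta2) * f (x2 - eta1) <= f (x1 - eta1) * f (x2 - eta2).

(* Up to normalization, the density of X_(2) - theta_(2) given U = u when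
   theta_(2) - theta_(1) = theta. *)
Definition cond_weight f theta u (z : R) : R :=
  f (z - u + theta) * f z + f (z - u) * f (z + theta).

End location_densities.

Section loss.
Context {R : realType}.
Implicit Types W h : R -> R.
Local Notation mu := (@lebesgue_measure R).

Definition C1 W :=
  [/\ W 0 = 0,
      forall x y, x < y -> y < 0 -> W y < W x &
      forall x y, 0 < x -> x < y -> W x < W y].

(* "Increasing" is read in the weak sense.  The total function derive1 W is only
   constrained off the null set N, where it is a genuine derivative. *)
Definition C2 W := exists2 N : set R, mu.-negligible N &
  (forall x, ~ N x -> derivable W x 1) /\
  (forall x y, ~ N x -> ~ N y -> x < y -> derive1 W x <= derive1 W y).

Definition loss_integral W h (c : R) : R := \int[mu]_z (W (z - c) * h z).

Definition diff_under_integral W h := forall c : R,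
  [/\ mu.-integrable setT (fun z => (W (z - c) * h z)%:E),
      mu.-integrable setT (fun z => (derive1 W (z - c) * h z)%:E) &
      is_derive c 1 (loss_integral W h) (- loss_integral (derive1 W) h c)].

Definition C3 W f := diff_under_integral W f /\
  forall theta u, 0 <= theta -> 0 < u ->
    diff_under_integral W (cond_weight f theta u).

Definition cond_risk W f theta u (c : R) : R :=
  loss_integral W (cond_weight f theta u) c /
  \int[mu]_z cond_weight f theta u z.

Definition is_minimizer (F : R -> R) c := forall c', F c <= F c'.

End loss.

Section random_variables.
Context {d : measure_display} {T : measurableType d} {R : realType}.
Implicit Types (P : probability T R) (X Y : {mfun T >-> R}).

Definition has_density P X (g : R -> R) := forall A : set R, measurable A ->
  distribution P X A = (\int[lebesgue_measure]_(x in A) (g x)%:E)%E.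

Definition independent P X Y := forall A B : set R,
  measurable A -> measurable B ->
  P (X @^-1` A `&` Y @^-1` B) = (P (X @^-1` A) * P (Y @^-1` B))%E.

(* theta = (theta_1, theta_2); P theta is the probability under theta. *)
Definition location_model (f : R -> R) (P : R * R -> probability T R) X Y :=
  forall theta : R * R,
  [/\ independent (P theta) X Y,
      has_density (P theta) X (fun x => f (x - theta.1)) &
      has_density (P theta) Y (fun x => f (x - theta.2))].

Definition smaller (x : R * R) : R := Num.min x.1 x.2.
Definition larger (x : R * R) : R := Num.max x.1 x.2.
Definition spacing (x : R * R) : R := larger x - smaller x.

Definition risk (P : R * R -> probability T R) X Y (W : R -> R)
    (theta : R * R) (delta : R * R -> R) : \bar R :=
  'E_(P theta)[(fun w => W (delta (X w, Y w) - larger theta)%R)]%E.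

Definition improves_upon (P : R * R -> probability T R) X Y (W : R -> R)
    (delta' delta : R * R -> R) :=
  (forall theta, risk P X Y W theta delta' <= risk P X Y W theta delta)%E /\
  (exists theta, risk P X Y W theta delta' < risk P X Y W theta delta)%E.

End random_variables.

(* Main.v *)
Require Import Defs.
From HB Require Import structures.
From mathcomp Require Import all_boot all_order all_algebra.
From mathcomp Require Import all_classical all_reals all_analysis.
From mathcomp Require Import measurable_realfun ring lra.

(* Given the spacing U = u > 0, the density of X_(2) - theta_(2) is proportional
   to w_theta = cond_weight f theta u, so the risk of X_(2) - phi(U) is the
   integral over u > 0 of the inner risk g_theta(phi(u)), where
   g_theta(a) = int W(z - a) w_theta(z) dz.  By (C2) the derivative of g_theta is
   nondecreasing, so g_theta is strictly decreasing before its only critical point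
   c(theta, u) and strictly increasing after it.  The MLR property makes
   w_theta / w_0 nonincreasing; since W' changes sign from - to + at 0, this gives
   c(theta, u) <= c(0, u).  Hence replacing c0 by c(0, u) whenever c(0, u) < c0
   strictly lowers the inner risk for every theta. *)

Import Order.TTheory GRing.Theory Num.Theory.
Import numFieldNormedType.Exports.

Set Implicit Arguments.
Unset Strict Implicit.
Unset Printing Implicit Defensive.

Local Open Scope classical_set_scope.
Local Open Scope ring_scope.

(** * Translations and reflections of Lebesgue measure *)

Section lebesgue_affine.
Context {R : realType}.
Local Notation mu := (@lebesgue_measure R).
Local Open Scope ereal_scope.

(** Lebesgue measure is the only measure that gives each half-open interval its length, and
    translating an interval keeps its length. *)
Lemma lebesgue_measure_shift (a : R) (A : set R) : measurable A ->
  pushforward mu (fun x : R => (x + a)%R : measurableTypeR R) A = mu A.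
Proof.
have mf : measurable_fun [set: R] (fun x : R => (x + a)%R : measurableTypeR R).
  by apply: measurable_funD.
pose m := measure_function_pushforward__canonical__measure_function_Measure mu mf.
move=> mA; apply/esym; apply: (@lebesgue_measure_unique R m) => //= _ [[b c]] _ <-.
rewrite /m /= /pushforward.
have -> : (fun x : R => (x + a)%R) @^-1` `]b, c]%classic =
    `](b - a)%R, (c - a)%R]%classic.
  by apply/seteqP; split=> x /=; rewrite !in_itv/= ltrBlDr lerBrDr.
by rewrite !lebesgue_measure_itv/= !lte_fin ltrD2r -!EFinB opprB addrA subrK.
Qed.

Lemma ge0_integral_shift (a : R) (F : R -> \bar R) :
  measurable_fun setT F -> (forall x, 0 <= F x) ->
  \int[mu]_x F (x + a)%R = \int[mu]_x F x.
Proof.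
move=> mF F0.
have mf : measurable_fun [set: measurableTypeR R]
    (fun x : R => (x + a)%R : measurableTypeR R).
  by apply: measurable_funD.
rewrite -[LHS](ge0_integral_pushforward mf (@lebesgue_measure R) measurableT)//=.
by apply: eq_measure_integral => //= A mA _; exact: lebesgue_measure_shift.
Qed.

Lemma ge0_integral_opp (F : R -> \bar R) :
  measurable_fun setT F -> (forall x, 0 <= F x) ->
  \int[mu]_x F (- x)%R = \int[mu]_x F x.
Proof.
move=> mF F0.
have mf : measurable_fun [set: measurableTypeR R] (-%R : R -> measurableTypeR R).
  by apply: measurable_funN.
rewrite -[LHS](ge0_integral_pushforward mf (@lebesgue_measure R) measurableT)//=.
by apply: eq_measure_integral => //= A mA _; exact: lebesgue_measureN.
Qed.

Lemma ge0_integral_reflect (a : R) (F : R -> \bar R) :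
  measurable_fun setT F -> (forall x, 0 <= F x) ->
  \int[mu]_x F (a - x)%R = \int[mu]_x F x.
Proof.
move=> mF F0; rewrite -[RHS](ge0_integral_shift a)// -ge0_integral_opp//=.
- by apply: eq_integral => x _; rewrite opprK addrC.
- by apply: (measurableT_comp mF); apply: measurable_funB.
Qed.

Lemma negligible_shift (c : R) (N : set R) :
  mu.-negligible N -> mu.-negligible [set z | N (z - c)%R].
Proof.
move=> [B [mB B0 NB]].
exists [set z | B (z - c)%R]; split; last by move=> z; exact: NB.
- have mf : measurable_fun [set: R] (fun x : R => (x - c)%R).
    by apply: measurable_funB.
  by have := mf measurableT _ mB; rewrite setTI.
- by have := @lebesgue_measure_shift (- c)%R _ mB; rewrite B0.
Qed.

End lebesgue_affine.

(** * Expectations of functions of variables with densities *)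

Section density.
Context {R : realType}.
Local Notation mu := (@lebesgue_measure R).
(* lebesgue_measure lives on measurableTypeR R, whose measurable sets are those of
   R but whose display differs from the canonical one. *)
Local Notation mR := (measurableTypeR R).

(** The measure [nu] is absolutely continuous, and its Radon-Nikodym derivative has the same
    integral as [g] over every measurable set, so the two agree almost everywhere. *)
Lemma ge0_integral_density (nu : {finite_measure set mR -> \bar R}) (g : mR -> R)
    (F : mR -> \bar R) :
  measurable_fun setT g -> (forall x, 0 <= g x) ->
  (forall A, measurable A -> nu A = \int[mu]_(x in A) (g x)%:E)%E ->
  measurable_fun setT F -> (forall x, 0 <= F x)%E ->
  (\int[nu]_x F x = \int[mu]_x (F x * (g x)%:E))%E.
Proof.
move=> mg g0 nug mF F0.
have dom : nu `<< mu.
  apply/null_content_dominatesP => A mA A0; rewrite nug//.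
  by apply: null_set_integral => //; apply/measurable_EFinP; exact: measurable_funTS.
rewrite -(Radon_Nikodym_SigmaFinite.change_of_variables dom)//.
apply: ge0_ae_eq_integral => //.
- apply: emeasurable_funM => //.
  exact: measurable_int (Radon_Nikodym_SigmaFinite.f_integrable dom).
- by apply: emeasurable_funM => //; apply/measurable_EFinP.
- by move=> x _; rewrite mule_ge0// Radon_Nikodym_SigmaFinite.f_ge0.
- by move=> x _; rewrite mule_ge0// lee_fin.
apply: ae_eqe_mul2l.
apply: integral_ae_eq => //.
- exact: Radon_Nikodym_SigmaFinite.f_integrable.
- exact/measurable_EFinP.
- by move=> E _ mE; rewrite -Radon_Nikodym_SigmaFinite.f_integral// nug.
Qed.

Lemma ge0_expectation_density d (T : measurableType d) (P : probability T R)
    (X : {mfun T >-> R}) (g : mR -> R) (F : mR -> \bar R) :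
  measurable_fun setT g -> (forall x, 0 <= g x) -> has_density P X g ->
  measurable_fun setT F -> (forall x, 0 <= F x)%E ->
  (\int[P]_w F (X w) = \int[mu]_x (F x * (g x)%:E))%E.
Proof.
move=> mg g0 Xg mF F0.
have mX : measurable_fun setT (X : T -> mR) by exact: (@measurable_funP _ _ _ _ setT X).
pose X' : {mfun T >-> mR} := HB.pack (X : T -> mR) (isMeasurableFun.Build _ _ _ _ _ mX).
rewrite -(@ge0_integral_density (distribution P X') _ _ mg g0 Xg mF F0).
by rewrite -[LHS](ge0_integral_pushforward mX P measurableT).
Qed.

(** Independence says that the joint law agrees with the product of the marginals on rectangles,
    hence everywhere. Tonelli then lets each marginal be replaced by its density in turn. *)
Lemma ge0_expectation_joint d (T : measurableType d) (P : probability T R)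
    (X Y : {mfun T >-> R}) (p q : mR -> R) (H : mR * mR -> \bar R) :
  independent P X Y ->
  measurable_fun setT p -> (forall x, 0 <= p x) -> has_density P X p ->
  measurable_fun setT q -> (forall x, 0 <= q x) -> has_density P Y q ->
  measurable_fun setT H -> (forall z, 0 <= H z)%E ->
  (\int[P]_w H (X w, Y w) =
   \int[mu]_y \int[mu]_x (H (x, y) * (p x)%:E * (q y)%:E))%E.
Proof.
move=> XY mp p0 Xp mq q0 Yq mH H0.
have mX : measurable_fun setT (X : T -> mR) by exact: (@measurable_funP _ _ _ _ setT X).
have mY : measurable_fun setT (Y : T -> mR) by exact: (@measurable_funP _ _ _ _ setT Y).
pose X' : {mfun T >-> mR} := HB.pack (X : T -> mR) (isMeasurableFun.Build _ _ _ _ _ mX).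
pose Y' : {mfun T >-> mR} := HB.pack (Y : T -> mR) (isMeasurableFun.Build _ _ _ _ _ mY).
pose phi w := (X' w, Y' w).
have mphi : measurable_fun setT phi by exact: measurable_fun_pair.
rewrite -[LHS](ge0_integral_pushforward mphi P measurableT)//.
transitivity (\int[(distribution P X' \x distribution P Y')%E]_z H z)%E.
  apply: eq_measure_integral => A mA _ /=.
  apply/esym.
  apply: (@product_measure_unique _ _ _ _ R (distribution P X') (distribution P Y')
    (measure_function_pushforward__canonical__measure_function_Measure P mphi)) => //.
rewrite fubini_tonelli2//.
have mG : measurable_fun setT (fubini_G (distribution P X') H).
  exact: measurable_fun_fubini_tonelli_G.
rewrite (@ge0_integral_density (distribution P Y') _ _ mq q0 Yq)//; last first.
  by move=> y; apply: integral_ge0 => x _; exact: H0.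
apply: eq_integral => y _.
have mHy : measurable_fun setT (fun x => H (x, y)) by exact: measurable_fun_pair1.
rewrite /fubini_G (@ge0_integral_density (distribution P X') _ _ mp p0 Xp)//.
rewrite -ge0_integralZr//.
- by apply: emeasurable_funM => //; exact/measurable_EFinP.
- by move=> x _; rewrite mule_ge0// lee_fin.
- by rewrite lee_fin.
Qed.

End density.

(** * The joint law of the spacing and the larger observation *)

Section spacing_law.
Context {R : realType}.
Local Notation mu := (@lebesgue_measure R).
Local Notation mR := (measurableTypeR R).
Local Open Scope ereal_scope.

(** Substitute [u = y - x] at fixed [y], exchange the integrals, then substitute [z = y - m] at
    fixed [u]. *)
Lemma ge0_integral_spacing (m : R) (p q : mR -> R) (h : mR * mR -> \bar R) :
  measurable_fun setT p -> (forall x, 0 <= p x)%R ->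
  measurable_fun setT q -> (forall x, 0 <= q x)%R ->
  measurable_fun setT h -> (forall z, 0 <= h z) ->
  \int[mu]_y \int[mu]_x (h (y - x, y - m)%R * (p x)%:E * (q y)%:E) =
  \int[mu]_u \int[mu]_z (h (u, z) * (p (z + m - u)%R * q (z + m)%R)%:E).
Proof.
move=> mp p0 mq q0 mh h0.
pose K (v : mR * mR) := h (v.1, v.2 - m)%R * (p (v.2 - v.1)%R * q v.2)%:E.
have K0 v : 0 <= K v by rewrite mule_ge0// lee_fin mulr_ge0.
have mK : measurable_fun setT K.
  apply: emeasurable_funM.
    apply: (measurableT_comp mh); apply: measurable_fun_pair => //.
    by apply: measurable_funB.
  apply/measurable_EFinP; apply: measurable_funM.
    by apply: (measurableT_comp mp); apply: measurable_funB.
  exact: measurableT_comp.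
transitivity (\int[mu]_y \int[mu]_u K (u, y)).
  apply: eq_integral => y _.
  rewrite -[RHS](ge0_integral_reflect y)//; last exact: (measurable_fun_pair1 _ mK).
  apply: eq_integral => x _; rewrite /K/= -muleA EFinM.
  by rewrite opprB addrCA subrr addr0.
rewrite -[LHS](@fubini_tonelli _ _ mR mR R mu mu K mK K0). apply: eq_integral => u _.
rewrite /fubini_F -[LHS](ge0_integral_shift m)//; last first.
  exact: (measurable_fun_pair2 _ mK).
by apply: eq_integral => z _; rewrite /K/= addrK.
Qed.

(** The plane is cut along the diagonal. Each open half-plane contributes one summand of the weight,
    according to which coordinate is the larger. *)
Lemma ge0_integral_spacing_larger (m : R) (p q : mR -> R) (h : mR * mR -> \bar R) :
  measurable_fun setT p -> (forall x, 0 <= p x)%R ->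
  measurable_fun setT q -> (forall x, 0 <= q x)%R ->
  measurable_fun setT h -> (forall z, 0 <= h z) ->
  \int[mu]_y \int[mu]_x
    (h (spacing (x, y), larger (x, y) - m)%R * (p x)%:E * (q y)%:E) =
  \int[mu]_(u in `]0%R, +oo[) \int[mu]_z
    (h (u, z) * (p (z + m - u) * q (z + m) + q (z + m - u) * p (z + m))%R%:E).
Proof.
move=> mp p0 mq q0 mh h0.
(* Extending by 0 encodes a half-plane in the integrand, so that the substitution over the whole
   plane applies. *)
pose k (v : mR * mR) := if (0 < v.1)%R then h v else 0.
have k0 v : 0 <= k v by rewrite /k; case: ifP.
have mk : measurable_fun setT k.
  apply: measurable_fun_ifT => //.
  by apply: measurable_fun_ltr => //; exact: measurable_fst.
have mpq : measurable_fun setT (fun v : mR * mR => (p v.1)%:E * (q v.2)%:E).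
  by apply: emeasurable_funM; apply/measurable_EFinP; exact: measurableT_comp.
have mkc (a b : mR * mR -> mR) : measurable_fun setT a -> measurable_fun setT b ->
    measurable_fun setT (fun v => k (a v, b v)).
  by move=> ma mb; apply: (measurableT_comp mk); exact: measurable_fun_pair.
(* [k1] lives on [x < y] and [k2] on [y < x]. *)
pose k1 (v : mR * mR) := k (v.2 - v.1, v.2 - m)%R * ((p v.1)%:E * (q v.2)%:E).
pose k2 (v : mR * mR) := k (v.1 - v.2, v.1 - m)%R * ((p v.1)%:E * (q v.2)%:E).
have pq0 (v : mR * mR) : 0 <= (p v.1)%:E * (q v.2)%:E by rewrite mule_ge0// lee_fin.
have k10 v : 0 <= k1 v by rewrite mule_ge0.
have k20 v : 0 <= k2 v by rewrite mule_ge0.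
have mk1 : measurable_fun setT k1.
  by apply: emeasurable_funM => //; apply: mkc; apply: measurable_funB.
have mk2 : measurable_fun setT k2.
  by apply: emeasurable_funM => //; apply: mkc; apply: measurable_funB.
have mmax : measurable_fun setT (larger : mR * mR -> R).
  by apply: measurable_maxr.
have mH : measurable_fun setT (fun v : mR * mR =>
    h (spacing v, larger v - m)%R * (p v.1)%:E * (q v.2)%:E).
  under eq_fun do rewrite -muleA.
  apply: emeasurable_funM => //; apply: (measurableT_comp mh).
  apply: measurable_fun_pair; apply: measurable_funB => //.
  exact: measurable_minr.
have HE x y : x != y -> h (spacing (x, y), larger (x, y) - m)%R * (p x)%:E * (q y)%:E =
    k1 (x, y) + k2 (x, y).
  rewrite neq_lt /k1 /k2 /k /spacing /larger /smaller /= => /orP[xy|xy].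
    by rewrite !subr_gt0 xy (lt_gtF xy) mul0e adde0 muleA max_r ?min_l// ltW.
  by rewrite !subr_gt0 xy (lt_gtF xy) mul0e add0e muleA max_l ?min_r// ltW.
transitivity (\int[mu]_y (\int[mu]_x k1 (x, y) + \int[mu]_x k2 (x, y))).
  apply: eq_integral => y _.
  rewrite -ge0_integralD//;
    [|exact: (measurable_fun_pair1 _ mk1)|exact: (measurable_fun_pair1 _ mk2)].
  apply: ge0_ae_eq_integral => //.
  - exact: (measurable_fun_pair1 _ mH).
  - by apply: emeasurable_funD;
      [exact: (measurable_fun_pair1 _ mk1)|exact: (measurable_fun_pair1 _ mk2)].
  - by move=> x _; rewrite !mule_ge0// lee_fin.
  - by move=> x _; rewrite adde_ge0.
  (* The diagonal meets each line of constant [y] in one point, a null set. *)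
  - exists [set y]; split; [exact: measurable_set1|exact: lebesgue_measure_set1|].
    move=> x/= /not_implyP[_ nE]; apply: contrapT => /eqP xy.
    exact/nE/HE.
rewrite ge0_integralD//; last 4 first.
- by move=> y _; exact: integral_ge0.
- exact: (measurable_fun_fubini_tonelli_G k1).
- by move=> y _; exact: integral_ge0.
- exact: (measurable_fun_fubini_tonelli_G k2).
(* For [k2] the larger coordinate is [x]; exchanging the integrals puts it outside, as
   [ge0_integral_spacing] requires, with [p] and [q] swapped. *)
rewrite -(fubini_tonelli k2)// /fubini_F /k1 /k2/=.
under eq_integral do under eq_integral do rewrite muleA.
under [X in _ + X]eq_integral do under eq_integral do rewrite (muleC (p _)%:E) muleA.
rewrite !ge0_integral_spacing//.
have mJ (p' q' : mR -> R) : measurable_fun setT p' -> measurable_fun setT q' ->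
    measurable_fun setT (fun v : mR * mR => k v * (p' (v.2 + m - v.1) * q' (v.2 + m))%R%:E).
  move=> mp' mq'; apply: emeasurable_funM => //; apply/measurable_EFinP.
  have m1 : measurable_fun setT (fun v : mR * mR => v.2 + m : R)%R.
    by apply: measurable_funD.
  apply: measurable_funM; last exact: (measurableT_comp mq').
  by apply: (measurableT_comp mp'); apply: measurable_funB.
have J0 (p' q' : mR -> R) : (forall x, 0 <= p' x)%R -> (forall x, 0 <= q' x)%R ->
    forall v : mR * mR, 0 <= k v * (p' (v.2 + m - v.1) * q' (v.2 + m))%R%:E.
  by move=> p'0 q'0 v; rewrite mule_ge0// lee_fin mulr_ge0.
rewrite -ge0_integralD//; last 4 first.
- by move=> u _; apply: integral_ge0 => z _; exact: (J0 p q p0 q0 (u, z)).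
- exact: (measurable_fun_fubini_tonelli_F _ (mJ p q mp mq) (J0 p q p0 q0)).
- by move=> u _; apply: integral_ge0 => z _; exact: (J0 q p q0 p0 (u, z)).
- exact: (measurable_fun_fubini_tonelli_F _ (mJ q p mq mp) (J0 q p q0 p0)).
rewrite [RHS]integral_mkcond; apply: eq_integral => u _.
rewrite patchE mem_setE/= in_itv/= andbT /k/=; case: ifPn => u0.
  rewrite -ge0_integralD//.
  - by apply: eq_integral => z _; rewrite -ge0_muleDr ?lee_fin ?mulr_ge0// EFinD.
  - by move=> z _; rewrite mule_ge0// lee_fin mulr_ge0.
  - by have := measurable_fun_pair2 u (mJ p q mp mq); rewrite /k/= u0.
  - by move=> z _; rewrite mule_ge0// lee_fin mulr_ge0.
  - by have := measurable_fun_pair2 u (mJ q p mq mp); rewrite /k/= u0.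
by rewrite !integral0_eq ?adde0// => z _; rewrite mul0e.
Qed.

Lemma location_expectation d (T : measurableType d) (P : R * R -> probability T R)
    (X Y : {mfun T >-> R}) (f : R -> R) (theta : R * R) (h : mR * mR -> \bar R) :
  is_pdf f -> location_model f P X Y ->
  measurable_fun setT h -> (forall v, 0 <= h v) ->
  \int[P theta]_w h (spacing (X w, Y w), larger (X w, Y w) - larger theta)%R =
  \int[mu]_(u in `]0%R, +oo[) \int[mu]_z
    (h (u, z) * (cond_weight f (spacing theta) u z)%:E).
Proof.
move=> [mf f0 _] /(_ theta)[XY Xf Yf] mh h0.
have mfs t : measurable_fun setT (fun x : mR => f (x - t)%R).
  by apply: (measurableT_comp mf); apply: measurable_funB.
have mH : measurable_fun setT (fun v : mR * mR => h (spacing v, larger v - larger theta)%R).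
  have mmax : measurable_fun setT (larger : mR * mR -> R) by apply: measurable_maxr.
  apply: (measurableT_comp mh); apply: measurable_fun_pair; apply: measurable_funB => //.
  exact: measurable_minr.
have fs0 t (x : mR) : (0 <= f (x - t))%R by exact: f0.
rewrite (ge0_expectation_joint XY (mfs _) (fs0 _) Xf (mfs _) (fs0 _) Yf mH (fun=> h0 _)).
have -> := ge0_integral_spacing_larger (larger theta)
  (mfs theta.1) (fs0 _) (mfs theta.2) (fs0 _) mh h0.
apply: eq_integral => u _; apply: eq_integral => z _; congr (_ * _%:E).
rewrite /cond_weight /spacing /larger /smaller.
(* The order of the two parameters only decides which summand of [cond_weight] comes first. *)
have [t12|t12] := leP theta.1 theta.2.
  by congr (f _ * f _ + f _ * f _)%R; ring.
by rewrite addrC; congr (f _ * f _ + f _ * f _)%R; ring.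
Qed.
End spacing_law.

(** * Comparison of real-valued integrals off a null set *)

Section Rintegral_ae.
Context d (T : measurableType d) {R : realType} (mu : {measure set T -> \bar R}).

Lemma Rintegral_ge0_ae (N : set T) (f : T -> R) :
  measurable_fun setT f -> mu.-negligible N -> (forall x, ~ N x -> 0 <= f x) ->
  0 <= \int[mu]_x f x.
Proof.
(* Integrability is not assumed: [f] and its absolute value agree almost everywhere, so their
   integrals coincide whether finite or not. *)
move=> mf N0 f0; have -> : \int[mu]_x f x = \int[mu]_x `|f x|.
  congr fine; apply: ae_eq_integral => //.
  - exact/measurable_EFinP.
  - by apply/measurable_EFinP; exact: measurableT_comp.
  - apply: negligibleS N0 => x /= /not_implyP[_ nE]; apply: contrapT => Nx.
    by apply: nE; rewrite ger0_norm// f0.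
exact: Rintegral_ge0.
Qed.

Lemma le_Rintegral_ae (N : set T) (f g : T -> R) :
  mu.-integrable setT (EFin \o f) -> mu.-integrable setT (EFin \o g) ->
  mu.-negligible N -> (forall x, ~ N x -> f x <= g x) ->
  \int[mu]_x f x <= \int[mu]_x g x.
Proof.
move=> If Ig N0 fg; rewrite -subr_ge0 -RintegralB//.
apply: (Rintegral_ge0_ae _ N0) => [|x Nx]; last by rewrite subr_ge0 fg.
apply: measurable_funB; apply/measurable_EFinP.
- exact: measurable_int Ig.
- exact: measurable_int If.
Qed.

End Rintegral_ae.

(** * Monotonicity of the integrated loss and comparison of its critical points *)

Section loss_monotonicity.
Context {R : realType}.
Local Notation mu := (@lebesgue_measure R).
Implicit Types W h : R -> R.

(** Points close to [x] are still negative, where [W] decreases, so the difference quotients are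
    nonpositive and so is their limit. *)
Lemma C1_derive1_le0 W x : C1 W -> derivable W x 1 -> x < 0 -> derive1 W x <= 0.
Proof.
move=> [_ Wdec _] dW x0; rewrite derive1E /derive.
apply: limr_le; first exact: dW.
near=> t.
have t0 : t != 0 by near: t; exact: nbhs_dnbhs_neq.
have tx : x + t < 0.
  rewrite -ltrBrDl sub0r; apply: le_lt_trans (ler_norm t) _.
  by near: t; apply: dnbhs0_lt; rewrite oppr_gt0.
rewrite /= [t%:A]mulr1 [t + x]addrC /GRing.scale /=.
have [tn|tp|t00] := ltgtP t 0; last by rewrite t00 eqxx in t0.
- rewrite mulr_le0_ge0 ?invr_le0 ?(ltW tn)// subr_ge0 ltW//.
  by apply: Wdec => //; rewrite gtrDl.
- rewrite mulr_ge0_le0 ?invr_ge0 ?(ltW tp)// subr_le0 ltW//.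
  by apply: Wdec => //; rewrite ltrDl.
Unshelve. all: by end_near. Qed.

Lemma C1_derive1_ge0 W x : C1 W -> derivable W x 1 -> 0 < x -> 0 <= derive1 W x.
Proof.
move=> [_ _ Winc] dW x0; rewrite derive1E /derive.
apply: limr_ge; first exact: dW.
near=> t.
have t0 : t != 0 by near: t; exact: nbhs_dnbhs_neq.
have tx : 0 < x + t.
  rewrite addrC -ltrBlDr sub0r ltrNl; apply: le_lt_trans (ler_norm (- t)) _.
  by rewrite normrN; near: t; exact: dnbhs0_lt.
rewrite /= [t%:A]mulr1 [t + x]addrC /GRing.scale /=.
have [tn|tp|t00] := ltgtP t 0; last by rewrite t00 eqxx in t0.
- rewrite mulr_le0 ?invr_le0 ?(ltW tn)// subr_le0 ltW//.
  by apply: Winc => //; rewrite gtrDl.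
- rewrite mulr_ge0 ?invr_ge0 ?(ltW tp)// subr_ge0 ltW//.
  by apply: Winc => //; rewrite ltrDl.
Unshelve. all: by end_near. Qed.

(** Off two translates of the exceptional set of (C2), [z - b < z - a] orders the integrands
    pointwise. *)
Lemma derive_loss_nonincr W h a b : C2 W -> diff_under_integral W h ->
  (forall z, 0 <= h z) -> a <= b ->
  loss_integral (derive1 W) h b <= loss_integral (derive1 W) h a.
Proof.
move=> [N N0 [_ W'mono]] dWh h0; rewrite le_eqVlt => /predU1P[->//|ab].
have [_ Ia _] := dWh a; have [_ Ib _] := dWh b.
apply: (le_Rintegral_ae Ib Ia
  (negligibleU (negligible_shift a N0) (negligible_shift b N0))).
move=> z /not_orP[/= Na Nb]; rewrite ler_wpM2r//.
by apply: W'mono => //; rewrite ltrD2l ltrN2.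
Qed.

Section unique_root.
Variables (W h : R -> R) (m : R).
Hypotheses (W_C2 : C2 W) (dWh : diff_under_integral W h) (h0 : forall z, 0 <= h z).
Hypothesis m_root : unique (fun a => loss_integral (derive1 W) h a = 0) m.

(** Weak monotonicity gives [<= 0], and uniqueness of the root excludes equality. *)
Lemma derive_loss_lt0 a : m < a -> loss_integral (derive1 W) h a < 0.
Proof.
case: m_root => m0 mu ma; rewrite lt_neqAle; apply/andP; split.
  by apply/eqP => /mu am; rewrite am ltxx in ma.
by rewrite -m0; exact: derive_loss_nonincr (ltW ma).
Qed.

Lemma derive_loss_gt0 a : a < m -> 0 < loss_integral (derive1 W) h a.
Proof.
case: m_root => m0 mu ma; rewrite lt_neqAle; apply/andP; split.
  by apply/eqP => /esym/mu am; rewrite am ltxx in ma.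
by rewrite -m0; exact: derive_loss_nonincr (ltW ma).
Qed.

Let loss_MVT a b : a < b -> exists2 x, x \in `]a, b[ &
  loss_integral W h b - loss_integral W h a =
  - loss_integral (derive1 W) h x * (b - a).
Proof.
move=> ab; apply: MVT => // [x _|]; first by have [] := dWh x.
apply: continuous_subspaceT => x.
apply: differentiable_continuous; apply/derivable1_diffP.
by have [_ _ []] := dWh x.
Qed.

Lemma loss_incr a b : m <= a -> a < b -> loss_integral W h a < loss_integral W h b.
Proof.
move=> ma ab; rewrite -subr_gt0; have [x] := loss_MVT ab.
rewrite in_itv/= => /andP[ax _] ->; rewrite mulr_gt0 ?subr_gt0// oppr_gt0.
by apply: derive_loss_lt0; exact: le_lt_trans ma ax.
Qed.

Lemma loss_decr a b : a < b -> b <= m -> loss_integral W h b < loss_integral W h a.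
Proof.
move=> ab bm; rewrite -subr_lt0; have [x] := loss_MVT ab.
rewrite in_itv/= => /andP[_ xb] ->; rewrite pmulr_llt0 ?subr_gt0// oppr_lt0.
by apply: derive_loss_gt0; exact: lt_le_trans xb bm.
Qed.

End unique_root.

(* The ratio h1/h0 is nonincreasing; its infimum lambda over {z < a} satisfies
   W'(z - a) h1(z) <= lambda W'(z - a) h0(z) for almost every z, on both sides of a.
   That infimum is over a nonempty set because the integral against h0 is negative. *)
Lemma derive_loss_le0 W h0 h1 a : C1 W -> C2 W ->
  diff_under_integral W h0 -> diff_under_integral W h1 ->
  (forall z, 0 <= h0 z) -> (forall z, 0 <= h1 z) ->
  (forall x y, x < y -> h1 y * h0 x <= h1 x * h0 y) ->
  loss_integral (derive1 W) h0 a < 0 -> loss_integral (derive1 W) h1 a <= 0.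
Proof.
move=> W_C1 [N N0 [dW _]] d0 d1 h00 h10 h01 L0.
have [_ I0 _] := d0 a; have [_ I1 _] := d1 a.
(* The point [a] is discarded because (C1) fixes the sign of [W'] only away from 0. *)
have Na : mu.-negligible ([set z | N (z - a)] `|` [set a]).
  apply: negligibleU (negligible_shift a N0) _.
  by apply/negligibleP => //; exact: lebesgue_measure_set1.
have W'le0 z : ~ N (z - a) -> z < a -> derive1 W (z - a) <= 0.
  by move=> Nz za; apply: C1_derive1_le0 => //; [exact: dW|rewrite subr_lt0].
have W'ge0 z : ~ N (z - a) -> a < z -> 0 <= derive1 W (z - a).
  by move=> Nz za; apply: C1_derive1_ge0 => //; [exact: dW|rewrite subr_gt0].
pose S := [set h1 z / h0 z | z in [set z | z < a /\ 0 < h0 z]].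
have [z0 [z0a h0z0]] : exists z, z < a /\ 0 < h0 z.
  apply: contrapT => /forallNP noz; move: L0; rewrite ltNge => /negP; apply.
  apply: (Rintegral_ge0_ae _ Na); first by apply/measurable_EFinP; exact: measurable_int I0.
  move=> z /not_orP[/= Nz za]; have [zlt|zgt|//] := ltgtP z a.
    have [h0z|] := ltP 0 (h0 z); first by case: (noz z).
    by move=> h0z; have -> : h0 z = 0; [apply/eqP; rewrite eq_le h0z h00|rewrite mulr0].
  by rewrite mulr_ge0// W'ge0.
have S0 : has_inf S.
  split; first by exists (h1 z0 / h0 z0), z0.
  by exists 0 => _ [z _ <-]; rewrite divr_ge0.
pose l := inf S.
have l0 : 0 <= l.
  by apply: lb_le_inf; [case: S0|move=> _ [z _ <-]; rewrite divr_ge0].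
(* Only [0 <= l] is known, so the strict sign for [h0] yields a weak one for [h1]. *)
apply: (@le_trans _ _ (l * loss_integral (derive1 W) h0 a)); last first.
  by rewrite mulr_ge0_le0// ltW.
rewrite -RintegralZl//; apply: (le_Rintegral_ae I1 _ Na).
  have := integrableZl measurableT l I0; exact: eq_integrable.
move=> z /not_orP[/= Nz za]; rewrite mulrCA.
have [zlt|zgt|//] := ltgtP z a.
- rewrite ler_wnM2l ?W'le0//.
  have [h0z|] := ltP 0 (h0 z); last first.
    by move=> h0z; have -> : h0 z = 0; [apply/eqP; rewrite eq_le h0z h00|rewrite mulr0].
  by rewrite -ler_pdivlMr//; apply: ge_inf; [case: S0|exists z].
- rewrite ler_wpM2l ?W'ge0//.
  have [h0z|] := ltP 0 (h0 z); last first.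
    (* To the right of [a], a zero of [h0] is a zero of [h1]: compare the ratios at [z0], where [h0]
       is positive. *)
    move=> h0z; have h0z0' : h0 z = 0 by apply/eqP; rewrite eq_le h0z h00.
    have := h01 z0 z (lt_trans z0a zgt); rewrite h0z0' !mulr0.
    by rewrite pmulr_lle0.
  rewrite -ler_pdivrMr//; apply: lb_le_inf; first by case: S0.
  move=> _ [x [xa h0x] <-]; rewrite ler_pdivrMr// mulrAC ler_pdivlMr//.
  exact: h01 (lt_trans xa zgt).
Qed.

(** If [m0 < m1], then at their midpoint the integral against [h0] is already negative while that
    against [h1] is still positive, contradicting [derive_loss_le0]. *)
Lemma unique_root_le W h0 h1 m0 m1 : C1 W -> C2 W ->
  diff_under_integral W h0 -> diff_under_integral W h1 ->
  (forall z, 0 <= h0 z) -> (forall z, 0 <= h1 z) ->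
  (forall x y, x < y -> h1 y * h0 x <= h1 x * h0 y) ->
  unique (fun a => loss_integral (derive1 W) h0 a = 0) m0 ->
  unique (fun a => loss_integral (derive1 W) h1 a = 0) m1 ->
  m1 <= m0.
Proof.
move=> W_C1 W_C2 d0 d1 h00 h10 h01 r0 r1; rewrite leNgt; apply/negP => m01.
have [a1 a2] := midf_lt m01; set a := _ / 2 in a1 a2.
have := derive_loss_le0 W_C1 W_C2 d0 d1 h00 h10 h01 (derive_loss_lt0 W_C2 d0 h00 r0 a1).
by rewrite leNgt (derive_loss_gt0 W_C2 d1 h10 r1 a2).
Qed.

(** Since [W 0 = 0], [W] is the sum of its restrictions to the two half-lines, extended by 0;
    nonnegativity makes each of them monotone on the whole line. *)
Lemma C1_measurable W : C1 W -> (forall t, 0 <= W t) -> measurable_fun setT W.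
Proof.
move=> [W0 Wdec Winc] Wge0.
pose l x := if x < 0 then W x else 0; pose r x := if 0 < x then W x else 0.
have -> : W = l \+ r.
  apply/funext => x /=; rewrite /l /r.
  by case: ltgtP => [||->]; rewrite ?addr0 ?add0r.
apply: measurable_funD.
- apply: nonincreasing_measurable => // x y; rewrite le_eqVlt => /predU1P[->//|xy].
  rewrite /l; case: ifPn => y0; last by case: ifP.
  by rewrite (lt_trans xy y0) ltW// Wdec.
- apply: nondecreasing_measurable => // x y; rewrite le_eqVlt => /predU1P[->//|xy].
  rewrite /r; case: ifPn => x0; last by case: ifP.
  by rewrite (lt_trans x0 xy) ltW// Winc.
Qed.

Section cond_weight_theory.
Variable f : R -> R.
Hypothesis f0 : forall x, 0 <= f x.

Lemma cond_weight_ge0 theta u z : 0 <= cond_weight f theta u z.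
Proof. by rewrite addr_ge0// mulr_ge0. Qed.

(** At parameter 0 the two summands of the weight coincide, so the claim splits into one MLR
    inequality per summand: for the pair [x - u < y - u], multiplied by [f x * f y], and for
    [x < y], multiplied by [f (x - u) * f (y - u)]. *)
Lemma cond_weight_ratio theta u x y : MLR f -> 0 <= theta -> x < y ->
  cond_weight f theta u y * cond_weight f 0 u x <=
  cond_weight f theta u x * cond_weight f 0 u y.
Proof.
move=> fMLR; rewrite le_eqVlt => /predU1P[<- _|t0 xy]; first by rewrite mulrC.
have shift a b : a < b -> f a * f (b + theta) <= f (a + theta) * f b.
  move=> ab; have := fMLR (a + theta) (b + theta) 0 theta.
  by rewrite !subr0 !addrK ltrD2r; exact.
have s1 := shift _ _ xy; have xyu : x - u < y - u by rewrite ltrD2r.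
have s2 := shift _ _ xyu.
rewrite /cond_weight !addr0.
have q1 := ler_wpM2r (mulr_ge0 (f0 x) (f0 y)) s2.
have q2 := ler_wpM2r (mulr_ge0 (f0 (x - u)) (f0 (y - u))) s1.
lra.
Qed.

End cond_weight_theory.

End loss_monotonicity.

(** * Strict inequality between integrals *)

Section strict_integral.
Context d (T : measurableType d) {R : realType} (mu : {measure set T -> \bar R}).
Local Open Scope ereal_scope.

(** Were the finite integrals equal, the nonnegative difference [g - f] would have integral 0 and
    vanish almost everywhere. *)
Lemma ge0_lt_integral (D : set T) (f g : T -> \bar R) : measurable D ->
  measurable_fun D f -> measurable_fun D g ->
  (forall x, D x -> 0 <= f x) -> (forall x, D x -> f x \is a fin_num) ->
  (forall x, D x -> f x <= g x) ->
  \int[mu]_(x in D) g x < +oo ->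
  ~ mu.-negligible (D `&` [set x | f x < g x]) ->
  \int[mu]_(x in D) f x < \int[mu]_(x in D) g x.
Proof.
move=> mD mf mg f0 ffin fg goo neg; rewrite ltNge; apply/negP => gf.
have fgE : \int[mu]_(x in D) f x = \int[mu]_(x in D) g x.
  apply/eqP; rewrite eq_le gf andbT; exact: ge0_le_integral.
have g0 x : D x -> 0 <= g x by move=> Dx; exact: le_trans (f0 x Dx) (fg x Dx).
have If : mu.-integrable D f.
  apply/integrableP; split => //; rewrite (eq_integral f) ?fgE// => x /[!inE] Dx.
  by rewrite gee0_abs// f0.
have Ig : mu.-integrable D g.
  apply/integrableP; split => //; rewrite (eq_integral g)// => x /[!inE] Dx.
  by rewrite gee0_abs// g0.
have B0 : \int[mu]_(x in D) (g \- f) x = 0.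
  rewrite integralB// fgE subee// ge0_fin_numE//; exact: integral_ge0.
have gf0 x : D x -> 0 <= (g \- f) x.
  by move=> Dx; rewrite /= sube_ge0 ?fg// ffin.
have /ae_eq_integral_abs : measurable_fun D (g \- f) by exact: emeasurable_funB.
move=> /(_ mu mD)[+ _].
rewrite (eq_integral (g \- f)); last first.
  by move=> x /[!inE] Dx; rewrite gee0_abs// gf0.
move=> /(_ B0) ae0; apply: neg; apply: negligibleS ae0 => x [Dx /= fgx] /(_ Dx)/=.
by move=> gfE; move: fgx; rewrite -sube_gt0 gfE ltxx.
Qed.

End strict_integral.

(** * Measurability of a minimizer *)

Section measurable_argmin.
Context d (T : measurableType d) {R : realType}.

(** By unimodality, [m u < a] holds exactly when some rational [q < a] has [F u q < F u a], a
    countable union of measurable conditions. This serves to show that [c 0] is measurable on the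
    positive half-line. *)
Lemma measurable_argmin (D : set T) (F : T -> R -> \bar R) (m : T -> R) :
  measurable D -> (forall a, measurable_fun D (F ^~ a)) ->
  (forall u a b, D u -> m u <= a -> a < b -> (F u a < F u b)%E) ->
  (forall u a b, D u -> a < b -> b <= m u -> (F u b < F u a)%E) ->
  measurable_fun D m.
Proof.
move=> mD mF Fincr Fdecr _.
apply: (measurability _ (RGenInftyO.measurableE R)) => //= _ [_ [a ->] <-].
have -> : D `&` m @^-1` `]-oo, a[%classic =
    \bigcup_q (if ratr q < a then D `&` [set u | (F u (ratr q) < F u a)%E] else set0).
  apply/seteqP; split => [u [Du]|u [q _]] /=.
    rewrite in_itv/= => /rat_in_itvoo[q]; rewrite in_itv/= => /andP[mq qa].
    by exists q => //; rewrite qa; split => //=; apply: Fincr => //; exact: ltW.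
  case: ifP => // qa [Du /= Fqa]; split => //; rewrite in_itv/= ltNge; apply/negP => am.
  by have := Fdecr _ _ _ Du qa am; rewrite (lt_gtF Fqa).
apply: bigcupT_measurable_rat => q; case: ifP => // _.
by apply: measurable_lte.
Qed.

End measurable_argmin.

(** * The risk as an integral over the spacing *)

Section risk_formula.
Context {R : realType}.
Local Notation mu := (@lebesgue_measure R).
Local Notation mR := (measurableTypeR R).
Variables (d : measure_display) (T : measurableType d) (P : R * R -> probability T R).
Variables (X1 X2 : {mfun T >-> R}) (f W : R -> R).
Hypotheses (f_pdf : is_pdf f) (model : location_model f P X1 X2).
Hypotheses (W_ge0 : forall t, 0 <= W t) (mW : measurable_fun setT W).

(** Extended values let Tonelli give measurability in [u] on the whole line, while (C3) ensures
    finiteness only for [u > 0] and [theta >= 0]. Without normalization, the density of the spacing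
    is already included. *)
Definition inner_risk theta u a : \bar R :=
  (\int[mu]_z (W (z - a) * cond_weight f theta u z)%:E)%E.

Let f0 x : 0 <= f x. Proof. by case: f_pdf. Qed.
Let mf : measurable_fun setT f. Proof. by case: f_pdf. Qed.

Let mcond theta : measurable_fun setT (fun v : mR * mR => cond_weight f theta v.1 v.2).
Proof.
have m1 : measurable_fun setT (fun v : mR * mR => v.2 - v.1 : R) by apply: measurable_funB.
apply: measurable_funD; apply: measurable_funM.
- by apply: (measurableT_comp mf); apply: measurable_funD.
- exact: (measurableT_comp mf).
- exact: (measurableT_comp mf).
- by apply: (measurableT_comp mf); apply: measurable_funD.
Qed.

Let mloss (phi : mR -> R) : measurable_fun setT phi ->
  measurable_fun setT (fun v : mR * mR => (W (v.2 - phi v.1))%:E).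
Proof.
move=> mphi; apply/measurable_EFinP; apply: (measurableT_comp mW).
by apply: measurable_funB => //; exact: (measurableT_comp mphi).
Qed.

Lemma measurable_inner_risk theta (phi : mR -> R) : measurable_fun setT phi ->
  measurable_fun setT (fun u : mR => inner_risk theta u (phi u)).
Proof.
move=> mphi.
apply: (measurable_fun_fubini_tonelli_F
  (fun v : mR * mR => (W (v.2 - phi v.1) * cond_weight f theta v.1 v.2)%:E)).
  under eq_fun do rewrite EFinM.
  by apply: emeasurable_funM; [exact: mloss|apply/measurable_EFinP; exact: mcond].
by move=> v; rewrite lee_fin mulr_ge0// cond_weight_ge0.
Qed.

Lemma inner_risk_ge0 theta u a : (0 <= inner_risk theta u a)%E.
Proof. by apply: integral_ge0 => z _; rewrite lee_fin mulr_ge0// cond_weight_ge0. Qed.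

Lemma risk_location theta (phi : mR -> R) : measurable_fun setT phi ->
  risk P X1 X2 W theta (fun x => larger x - phi (spacing x)) =
  (\int[mu]_(u in `]0%R, +oo[) inner_risk (spacing theta) u (phi u))%E.
Proof.
move=> mphi; rewrite /risk unlock.
have := @location_expectation _ _ _ P X1 X2 f theta _ f_pdf model (mloss mphi) _.
move=> /=; under eq_integral do rewrite addrAC.
move=> ->; first by under eq_integral do under eq_integral do rewrite -EFinM.
by move=> v; rewrite lee_fin.
Qed.

(** The contrapositive turns positive probability under one parameter into positive Lebesgue
    measure, a condition free of the parameter. *)
Lemma spacing_null theta (A : set mR) : measurable A ->
  mu.-negligible (`]0%R, +oo[ `&` A) ->
  P theta [set w | A (spacing (X1 w, X2 w))] = 0%E.
Proof.
move=> mA A0.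
have mS : measurable_fun setT (fun w => spacing (X1 w, X2 w) : mR).
  by apply: measurable_funB; [exact: measurable_maxr|exact: measurable_minr].
have mB : measurable [set w | A (spacing (X1 w, X2 w))].
  by have := mS measurableT _ mA; rewrite setTI.
rewrite -[X in P theta X]setIT -integral_indic//.
pose h (v : mR * mR) : \bar R := (\1_A v.1)%:E.
have mh : measurable_fun setT h.
  by apply/measurable_EFinP; exact: (measurableT_comp (measurable_indic mA)).
have h0 v : (0 <= h v)%E by rewrite lee_fin.
have mhw : measurable_fun setT (fun v : mR * mR =>
    h v * (cond_weight f (spacing theta) v.1 v.2)%:E)%E.
  by apply: emeasurable_funM => //; apply/measurable_EFinP; exact: mcond.
have hw0 (v : mR * mR) : (0 <= h v * (cond_weight f (spacing theta) v.1 v.2)%:E)%E.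
  by rewrite mule_ge0// lee_fin cond_weight_ge0.
have := location_expectation theta f_pdf model mh h0; rewrite /h/= => ->.
rewrite (ge0_ae_eq_integral (g := cst 0%E)) ?integral0//.
- by apply: measurable_funTS; exact: (measurable_fun_fubini_tonelli_F _ mhw hw0).
- by move=> u _; apply: integral_ge0 => z _; exact: (hw0 (u, z)).
apply: negligibleS A0 => u /= /not_implyP[u0 nE]; split => //.
apply: contrapT => nA; apply: nE; apply: integral0_eq => z _.
by rewrite indicE memNset// mul0e.
Qed.

(** The maximum is one of the two observations, so its loss is at most the sum of theirs. At the
    origin both have density [f], against which the loss is integrable. *)
Lemma risk_larger_lt_pinfty a :
  (\int[mu]_x (W (x - a) * f x)%:E < +oo)%E ->
  (risk P X1 X2 W (0%R, 0%R) (fun x => (larger x - a)%R) < +oo)%E.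
Proof.
move=> Woo.
have mWa : measurable_fun setT (fun x : mR => (W (x - a))%:E).
  by apply/measurable_EFinP; apply: (measurableT_comp mW); apply: measurable_funB.
have Wa0 (x : mR) : (0 <= (W (x - a))%:E)%E by rewrite lee_fin.
have [_ Xf Yf] := model (0, 0).
have mfs : measurable_fun setT (fun x : mR => f (x - 0)).
  by apply: (measurableT_comp mf); apply: measurable_funB.
have fs0 (x : mR) : 0 <= f (x - 0) by exact: f0.
have finite (X : {mfun T >-> R}) : has_density (P (0, 0)) X (fun x => f (x - 0)) ->
    (\int[P (0%R, 0%R)]_w (W (X w - a))%:E < +oo)%E.
  move=> Xf'; rewrite (ge0_expectation_density mfs fs0 Xf' mWa Wa0).
  by under eq_integral do rewrite -EFinM subr0.
have mWX (X : {mfun T >-> R}) : measurable_fun setT (fun w => (W (X w - a))%:E).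
  by apply/measurable_EFinP; apply: (measurableT_comp mW); apply: measurable_funB.
rewrite /risk unlock; apply: (@le_lt_trans _ _
  (\int[P (0%R, 0%R)]_w ((W (X1 w - a))%:E + (W (X2 w - a))%:E))%E).
  apply: ge0_le_integral => //.
  - by move=> w _; rewrite lee_fin.
  - apply/measurable_EFinP; apply: (measurableT_comp mW).
    by do 2! apply: measurable_funB => //; exact: measurable_maxr.
  - exact: emeasurable_funD.
  - move=> w _; rewrite /larger/= maxxx subr0 -EFinD lee_fin.
    by rewrite /Order.max; case: ifP => _; rewrite ?lerDl ?lerDr.
by rewrite ge0_integralD// lte_add_pinfty// finite.
Qed.

End risk_formula.

(** * Domination of the natural estimator *)

Lemma spacing_ge0 (R : realType) (x : R * R) : 0 <= spacing x.
Proof. by rewrite subr_ge0 ge_min !le_max lexx. Qed.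

Theorem corollary2p2 (R : realType) (d : measure_display)
    (T : measurableType d) (P : R * R -> probability T R)
    (X1 X2 : {mfun T >-> R}) (f W : R -> R) (c : R -> R -> R) (c0 : R)
    (f_pdf : is_pdf f)
    (model : location_model f P X1 X2)
    (f_MLR : MLR f)
    (W_ge0 : forall t, 0 <= W t)
    (W_C1 : C1 W) (W_C2 : C2 W) (W_C3 : C3 W f)
    (c_min : forall theta u, 0 <= theta -> 0 < u ->
      unique (is_minimizer (cond_risk W f theta u)) (c theta u))
    (c_root : forall theta u, 0 <= theta -> 0 < u ->
      unique (fun a => loss_integral (derive1 W) (cond_weight f theta u) a = 0)
             (c theta u))
    (c0_root : unique (fun a => loss_integral (derive1 W) f a = 0) c0)
    (c0_gt : exists theta,
      (0 < P theta [set w | c 0 (spacing (X1 w, X2 w)) < c0]%R)%E) :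
  improves_upon P X1 X2 W
    (fun x => larger x - Num.min c0 (c 0 (spacing x)))
    (fun x => larger x - c0).
Proof.
have [mf f0 _] := f_pdf; have [Wf Wcond] := W_C3.
have mW := C1_measurable W_C1 W_ge0.
pose mR := measurableTypeR R.
pose D : set mR := `]0, +oo[%classic.
have mD : measurable D by exact: measurable_itv.
have w0 theta u z : 0 <= cond_weight f theta u z by exact: cond_weight_ge0.
have innerE theta u a : 0 <= theta -> 0 < u ->
    inner_risk f W theta u a = (loss_integral W (cond_weight f theta u) a)%:E.
  move=> t0 u0; rewrite /loss_integral /Rintegral fineK//.
  by apply: integrable_fin_num => //; have [] := Wcond _ _ t0 u0 a.
(* c 0 u is unconstrained for u <= 0; the spacing only takes nonnegative values. *)
pose ct (u : mR) := if 0 < u then c 0 u else c 0 0.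
have ctE (x : R * R) : ct (spacing x) = c 0 (spacing x).
  by rewrite /ct; case: ltgtP (spacing_ge0 x) => // <-.
have mct : measurable_fun setT ct.
  apply: measurable_fun_if => //; first by apply: measurable_fun_ltr.
  rewrite setTI; apply: (@measurable_argmin _ _ _ _ (fun u a => inner_risk f W 0 u a)) => //.
  - have -> : (fun u : mR => 0 < u) @^-1` [set true] = D; last exact: measurable_itv.
    by apply/seteqP; split => u; rewrite /D /= in_itv/= andbT.
  - move=> a; apply: measurable_funTS.
    exact: (measurable_inner_risk f_pdf W_ge0 mW 0 (measurable_cst a)).
  - move=> u a b /= u0 ca ab; rewrite !innerE// lte_fin.
    by apply: (loss_incr W_C2 (Wcond _ _ _ _) (w0 _ _) (c_root _ _ _ _) ca ab).
  - move=> u a b /= u0 ab bc; rewrite !innerE// lte_fin.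
    by apply: (loss_decr W_C2 (Wcond _ _ _ _) (w0 _ _) (c_root _ _ _ _) ab bc).
pose phi (u : mR) := Num.min c0 (ct u).
have mphi : measurable_fun setT phi by apply: measurable_minr.
have phiE : (fun x => larger x - Num.min c0 (c 0 (spacing x))) =
    (fun x => larger x - phi (spacing x)).
  by apply/funext => x; rewrite /phi ctE.
have lt_inner theta u : 0 <= theta -> D u -> ct u < c0 ->
    (inner_risk f W theta u (phi u) < inner_risk f W theta u c0)%E.
  move=> t0; rewrite /D/= in_itv/= andbT => u0 cu.
  rewrite /phi min_r ?(ltW cu)//; move: cu; rewrite /ct u0 => cu.
  rewrite !innerE// lte_fin.
  have c1 := c_root _ _ t0 u0; have dt := Wcond _ _ t0 u0.
  have c2 := c_root _ _ (lexx 0) u0; have d0 := Wcond _ _ (lexx 0) u0.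
  (* Both [c 0 u] and [c0] lie on the increasing branch, which starts at [c theta u <= c 0 u]. *)
  apply: (loss_incr W_C2 dt (w0 _ _) c1 _ cu).
  apply: (unique_root_le W_C1 W_C2 d0 dt (w0 _ _) (w0 _ _) _ c2 c1) => x y xy.
  exact: cond_weight_ratio.
have le_inner theta u : 0 <= theta -> D u ->
    (inner_risk f W theta u (phi u) <= inner_risk f W theta u c0)%E.
  move=> t0 Du; have [cu|cu] := ltP (ct u) c0; first exact/ltW/lt_inner.
  by rewrite /phi min_l.
have mI theta (p : mR -> R) : measurable_fun setT p ->
    measurable_fun D (fun u => inner_risk f W theta u (p u)).
  by move=> mp; apply: measurable_funTS; exact: measurable_inner_risk.
rewrite phiE; split => [theta|].
  rewrite (risk_location f_pdf model W_ge0 mW _ mphi).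
  rewrite (risk_location f_pdf model W_ge0 mW _ (measurable_cst c0)).
  apply: ge0_le_integral => //.
  - by move=> u _; exact: inner_risk_ge0.
  - exact: mI.
  - exact: (mI _ _ (measurable_cst c0)).
  - by move=> u Du; apply: le_inner => //; exact: spacing_ge0.
(* Strictness is shown at the origin, where the risk of the natural estimator is finite, whatever
   parameter [c0_gt] supplies. *)
exists (0%R, 0%R).
rewrite (risk_location f_pdf model W_ge0 mW _ mphi).
have finite0 : (risk P X1 X2 W (0%R, 0%R) (fun x => (larger x - c0)%R) < +oo)%E.
  apply: (risk_larger_lt_pinfty f_pdf model W_ge0 mW).
  have [/integrableP[_ +] _ _] := Wf c0.
  by under eq_integral do rewrite gee0_abs ?lee_fin ?mulr_ge0//.
move: finite0.
rewrite (risk_location f_pdf model W_ge0 mW _ (measurable_cst c0)) => finite0.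
apply: ge0_lt_integral => //.
- exact: mI.
- exact: (mI _ _ (measurable_cst c0)).
- by move=> u _; exact: inner_risk_ge0.
- by move=> u; rewrite /D/= in_itv/= andbT => u0; rewrite innerE// spacing_ge0.
- by move=> u Du; apply: le_inner => //; exact: spacing_ge0.
(* If the inner risks differed only on a null set of [u > 0], the event in [c0_gt] would have
   probability 0 under every parameter. *)
move=> negl; have [theta] := c0_gt; apply/negP; rewrite -leNgt.
pose A : set mR := [set u | ct u < c0].
have mA : measurable A.
  have -> : A = setT `&` ct @^-1` `]-oo, c0[%classic.
    by apply/seteqP; split => u /=; rewrite /A/= in_itv/= => // -[].
  exact: mct.
have -> : [set w | c 0 (spacing (X1 w, X2 w)) < c0] = [set w | A (spacing (X1 w, X2 w))].
  by apply/seteqP; split => w; rewrite /A/= ctE.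
rewrite (spacing_null f_pdf model theta mA)//.
apply: negligibleS negl => u [Du Au]; split => //.
by apply: lt_inner => //; exact: spacing_ge0.
Qed.
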